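(* Let $G$ be a group of infinite order $\kappa$ with no involutions, and let $I$ be an index set (in an ordered field $\mathbb{F}$) with $|I|=|G|$. If $G$ has a directed $S_\infty$-terrace for $I$, then there is a semi-Vatican square of order $|G|$.
   Context: Let $\mathbb{F}$ be an ordered field and $I\subseteq\mathbb{F}$; for $d\in\mathbb{F}^+$ put $I_{(d)}=\{i\in I:i+d\in I\}$. $I$ is an index set if $|I|=|\mathbb{F}|$ and for every $d\in\mathbb{F}^+$ either $|I_{(d)}|=|\mathbb{F}|$ or $I_{(d)}=\emptyset$. A Latin square on $I$ with symbol set $X$ is a function $L:I\times I\to X$ such that for each $i\in I$ both $j\mapsto L(i,j)$ and $j\mapsto L(j,i)$ are bijections $I\to X$; its order is $|X|$. $L$ is semi-Vatican if for every $d\in\mathbb{F}^+$ with $I_{(d)}\ne\emptyset$ and every unordered pair $\{x,y\}$ of distinct symbols there is exactly one $(i,j)$ with $j\in I_{(d)}$ and $\{L(i,j),L(i,j+d)\}=\{x,y\}$, and exactly one $(i,j)$ with $i\in I_{(d)}$ and $\{L(i,j),L(i+d,j)\}=\{x,y\}$. For a group $G$ without involutions and a bijection $\mathbf a:I\to G$, let $\mathbf a_{(d)}(i)=\mathbf a(i)^{-1}\mathbf a(i+d)$ for $i\in I_{(d)}$; $\mathbf a$ is a directed $S_\infty$-terrace if for every $d\in\mathbb{F}^+$ with $I_{(d)}\neq\emptyset$, for each set $\{x,x^{-1}\}$ with $x\in G\setminus\{e\}$, exactly one $i\in I_{(d)}$ has $\mathbf a_{(d)}(i)\in\{x,x^{-1}\}$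 (and $\mathbf a_{(d)}$ never takes the value $e$). *)

(* Defs.v *)
From mathcomp Require Import all_boot all_order all_algebra.
From mathcomp Require Import classical_sets functions cardinality.

Set Implicit Arguments.
Unset Strict Implicit.
Unset Printing Implicit Defensive.

Import Order.TTheory GRing.Theory Num.Theory.

Local Open Scope classical_set_scope.
Local Open Scope card_scope.
Local Open Scope ring_scope.

(* I_(d) = {i in I : i + d in I} *)
Definition shift_set (F : realFieldType) (I : set F) (d : F) : set F :=
  [set i | I i /\ I (i + d)].

Definition index_set (F : realFieldType) (I : set F) : Prop :=
  I #= [set: F] /\
  forall d : F, 0 < d ->
    shift_set I d #= [set: F] \/ shift_set I d = set0.

(* A function on I (resp. I x I) is represented by a total function on F
   (resp. F and F); only its values on I are ever constrained or used.
   The symbol set is the whole type X, so the order of the square is the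
   cardinality of [set: X]. *)
Definition latin_square (F : realFieldType) (I : set F) (X : Type)
    (L : F -> F -> X) : Prop :=
  forall i : F, I i ->
    set_bij I [set: X] (fun j => L i j) /\ set_bij I [set: X] (fun j => L j i).

Definition semi_vatican (F : realFieldType) (I : set F) (X : Type)
    (L : F -> F -> X) : Prop :=
  latin_square I L /\
  forall d : F, 0 < d -> shift_set I d !=set0 ->
  forall x y : X, x <> y ->
    (exists! p : F * F, [/\ I p.1, shift_set I d p.2 &
       [set L p.1 p.2; L p.1 (p.2 + d)] = [set x; y]]) /\
    (exists! p : F * F, [/\ shift_set I d p.1, I p.2 &
       [set L p.1 p.2; L (p.1 + d) p.2] = [set x; y]]).

Definition no_involutions (G : groupType) : Prop :=
  ~ exists x : G, x <> 1%g /\ (x ^+ 2)%g = 1%g.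

(* a_(d)(i) = a(i)^-1 a(i + d) *)
Definition shift_quotient (F : realFieldType) (G : groupType) (a : F -> G)
    (d i : F) : G :=
  ((a i)^-1 * a (i + d)%R)%g.

Definition directed_Sinfty_terrace (F : realFieldType) (I : set F) (G : groupType)
    (a : F -> G) : Prop :=
  set_bij I [set: G] a /\
  forall d : F, 0 < d -> shift_set I d !=set0 ->
    (forall i : F, shift_set I d i -> shift_quotient a d i <> 1%g) /\
    (forall x : G, x <> 1%g ->
       exists! i : F, shift_set I d i /\
         [set x; (x^-1)%g] (shift_quotient a d i)).

(* Main.v *)
(* For a terrace a, the square L(i, j) = a(i)^-1 a(j) works. Along a row,
   L(i, j)^-1 L(i, j + d) = a(j)^-1 a(j + d) does not depend on i, so the
   terrace property locates each unordered pair; L(j, i) = L(i, j)^-1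
   transfers this to columns. *)
Require Import Defs.
From mathcomp Require Import all_boot all_order all_algebra.
From mathcomp Require Import classical_sets functions cardinality.

Local Open Scope classical_set_scope.
Local Open Scope card_scope.
Local Open Scope ring_scope.

Set Implicit Arguments.
Unset Strict Implicit.

Lemma set2_eqP (T : Type) (u v x y : T) :
  [set u; v] = [set x; y] <-> (u = x /\ v = y) \/ (u = y /\ v = x).
Proof.
split=> [E|[[-> ->]|[-> ->]] //]; last by rewrite setUC.
have Hu : [set x; y] u by rewrite -E; left.
have Hv : [set x; y] v by rewrite -E; right.
have Hx : [set u; v] x by rewrite E; left.
have Hy : [set u; v] y by rewrite E; right.
by case: Hu => /= ?; case: Hv => /= ?; case: Hx => /= ?; case: Hy => /= ?; subst; auto.
Qed.

(** Injectivity of inversion, applied to unordered pairs; this translates the pair condition between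
    rows and columns. *)
Lemma set2_invg (G : groupType) (u v x y : G) :
  [set (u^-1)%g; (v^-1)%g] = [set (x^-1)%g; (y^-1)%g] <->
  [set u; v] = [set x; y].
Proof.
by rewrite !set2_eqP; split=> -[[]|[]];
  [move=> /invg_inj -> /invg_inj ->; left
  |move=> /invg_inj -> /invg_inj ->; right
  |move=> -> ->; left|move=> -> ->; right].
Qed.

Lemma no_involutions_invg_neq (G : groupType) (x : G) :
  no_involutions G -> x <> 1%g -> (x^-1)%g <> x.
Proof.
by move=> noinv x1 xV; apply: noinv; exists x; split=> //; rewrite expg2 -{1}xV mulVg.
Qed.

Definition quotient_square (F : realFieldType) (G : groupType) (a : F -> G)
    (i j : F) : G :=
  ((a i)^-1 * a j)%g.

Lemma quotient_squareV (F : realFieldType) (G : groupType) (a : F -> G) i j :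
  ((quotient_square a i j)^-1)%g = quotient_square a j i.
Proof. by rewrite /quotient_square invgM invgK. Qed.

Lemma quotient_square_shift (F : realFieldType) (G : groupType) (a : F -> G)
    (i j d : F) :
  shift_quotient a d j =
  ((quotient_square a i j)^-1 * quotient_square a i (j + d))%g.
Proof. by rewrite /shift_quotient /quotient_square invgM invgK -mulgA mulVKg. Qed.

(** Row [i] is [a] followed by left translation by [(a i)^-1]. *)
Lemma quotient_square_row_bij (F : realFieldType) (I : set F) (G : groupType)
    (a : F -> G) (i : F) :
  set_bij I [set: G] a -> set_bij I [set: G] (quotient_square a i).
Proof.
move=> [_ ainj asurj]; split=> // [j k jI kI /mulgI|x _]; first exact: ainj.
have [j jI aj] := asurj (a i * x)%g Logic.I.
by exists j; rewrite // /quotient_square aj mulKg.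
Qed.

(** Column [i] is row [i] followed by inversion, so its bijectivity reduces to that of the row. *)
Lemma quotient_square_latin (F : realFieldType) (I : set F) (G : groupType)
    (a : F -> G) :
  set_bij I [set: G] a -> latin_square I (quotient_square a).
Proof.
move=> abij i _; have [_ rinj rsurj] := quotient_square_row_bij i abij.
split; first exact: quotient_square_row_bij.
split=> // [j k jI kI|x _].
  rewrite -(quotient_squareV a i j) -(quotient_squareV a i k) => /invg_inj.
  exact: rinj.
have [j jI jx] := rsurj (x^-1)%g Logic.I.
by exists j; rewrite // -quotient_squareV jx invgK.
Qed.

Section Terrace.
Variables (F : realFieldType) (I : set F) (G : groupType) (a : F -> G).
Hypotheses (noinv : no_involutions G) (terr : directed_Sinfty_terrace I a).
Variable d : F.
Hypotheses (d_gt0 : 0 < d) (Id_neq0 : shift_set I d !=set0).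

Local Notation L := (quotient_square a).

(* The column j of a pair {x, y} is the one where the quotient of the terrace
   is x^-1 y or its inverse; as these differ, the order in which x and y occur
   in columns j and j + d is forced, and this fixes the row. *)
Lemma terrace_row_pair (x y : G) : x <> y ->
  exists! p : F * F, [/\ I p.1, shift_set I d p.2 &
    [set L p.1 p.2; L p.1 (p.2 + d)] = [set x; y]].
Proof.
have [[_ ainj asurj] /(_ d d_gt0 Id_neq0)[_ qex]] := terr.
have quoV (s t : G) : ((s^-1 * t)^-1 = t^-1 * s)%g by rewrite invgM invgK.
have row_ex j s : exists2 i, I i & L i j = s.
  have [i iI ai] := asurj (a j * s^-1)%g Logic.I.
  by exists i; rewrite // /quotient_square ai invgM invgK mulgVK.
have row_inj j i k : I i -> I k -> L i j = L k j -> i = k.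
  by move=> iI kI /mulIg /invg_inj; apply: ainj; apply: mem_set.
(* The row is chosen so that [s] stands in column [j]; the quotient then forces [t] in column
   [j + d]. *)
have pair_ex j s t : shift_quotient a d j = (s^-1 * t)%g ->
    exists2 i, I i & L i j = s /\ L i (j + d) = t.
  move=> qj; have [i iI Lij] := row_ex j s; exists i => //; split=> //.
  by move: qj; rewrite (quotient_square_shift a i) Lij => /mulgI.
move=> xy; set z := (x^-1 * y)%g.
have z1 : z <> 1%g.
  by move=> z1; apply: xy; rewrite -[RHS](mulVKg x) -/z z1 mulg1.
have [j [[jI jq] juniq]] := qex z z1.
(* The terrace gives the quotient at [j] only up to inversion: [z] puts [x] in column [j], while
   [z^-1] puts [y] there. *)
have [i iI Lij] : exists2 i, I i & [set L i j; L i (j + d)] = [set x; y].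
  have [qj|qj] : shift_quotient a d j = z \/ shift_quotient a d j = (z^-1)%g.
  - by case: jq => /=; [left|right].
  - have [i iI Li] := pair_ex j x y qj.
    by exists i => //; apply/set2_eqP; left.
  - rewrite quoV in qj; have [i iI Li] := pair_ex j y x qj.
    by exists i => //; apply/set2_eqP; right.
exists (i, j); split=> [//|[i' j'] [/= i'I j'I /set2_eqP Lij']].
(* Any occurrence of the pair has quotient [z] or [z^-1] at its column, so the terrace leaves only
   one column. *)
have jj' : j = j'.
  apply: juniq; split=> //; rewrite (quotient_square_shift a i').
  by case: Lij' => -[-> ->]; [left|right; rewrite /= quoV].
subst j'; congr (_, _); apply: (row_inj j) => //.
(* If rows [i] and [i'] held the pair in opposite orders, the quotient at [j] would be both [z] and
   [z^-1]. *)
have zV := no_involutions_invg_neq noinv z1.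
have := quotient_square_shift a i j d.
rewrite (quotient_square_shift a i').
case: Lij' => -[-> ->]; move/set2_eqP: Lij => -[[-> ->]|[-> ->]] //.
- by rewrite -(quoV x y) => /esym.
- by rewrite -(quoV x y).
Qed.

(** Transposing the square inverts its entries, so occurrences of [x], [y] in columns are those of
    [x^-1], [y^-1] in rows with the coordinates swapped. *)
Lemma terrace_column_pair (x y : G) : x <> y ->
  exists! p : F * F, [/\ shift_set I d p.1, I p.2 &
    [set L p.1 p.2; L (p.1 + d) p.2] = [set x; y]].
Proof.
move=> xy.
have xyV : (x^-1)%g <> (y^-1)%g by move=> /invg_inj.
have [[j i] [[/= jI iI E] uniq]] := terrace_row_pair xyV.
exists (i, j); split=> [|[i' j'] [/= i'I j'I E']].
  by split=> //=; apply/set2_invg; rewrite !quotient_squareV.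
suff : (j, i) = (j', i') by case=> -> ->.
apply: uniq; split=> //=.
by rewrite -!(quotient_squareV a _ j'); apply/set2_invg.
Qed.

End Terrace.

Theorem theorem4p1 (F : realFieldType) (I : set F) (G : groupType)
    (G_infinite : infinite_set [set: G])
    (G_noinv : no_involutions G)
    (I_index : index_set I)
    (card_I_G : I #= [set: G])
    (G_terrace : exists a : F -> G, directed_Sinfty_terrace I a) :
  exists (X : Type) (L : F -> F -> X),
    semi_vatican I L /\ [set: X] #= [set: G].
Proof.
have [a terr] := G_terrace.
exists G, (quotient_square a); split; last exact: card_eqxx.
split; first by apply: quotient_square_latin; case: terr.
move=> d d_gt0 Id x y xy.
by split; [apply: terrace_row_pair|apply: terrace_column_pair].
Qed.
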